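(* Let $\mathbf{k}$ be a field, $R=\mathbf{k}[\![x_1,\dots,x_n]\!]$ with maximal ideal $\mathfrak m$, and $S=\mathbf{k}[y_1,\dots,y_n]$ with the contraction $R$-module structure. Let $M$ be a sub-$R$-module of $S$ and let $\{b_1,\dots,b_s\}$ be a $\mathbf{k}$-basis of $M$. Let $\Lambda\in S$ be a polynomial with no constant term. Then $\Lambda\in\int_{\mathfrak m}M$ if and only if there exist scalars $\lambda_j^k\in\mathbf{k}$ ($1\le k\le n$, $1\le j\le s$) such that $$\Lambda=\sum_{j=1}^s\lambda_j^1\int_1 b_j\Big|_{y_2=\cdots=y_n=0}+\sum_{j=1}^s\lambda_j^2\int_2 b_j\Big|_{y_3=\cdots=y_n=0}+\dots+\sum_{j=1}^s\lambda_j^n\int_n b_j$$ and $$\sum_{j=1}^s\lambda_j^k\,(x_l\circ b_j)-\sum_{j=1}^s\lambda_j^l\,(x_k\circ b_j)=0\qquad\text{for all }1\le k<l\le n.$$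
   Context: Contraction: $x^\alpha\circ y^\beta=y^{\beta-\alpha}$ if $\beta\ge\alpha$ componentwise and $0$ otherwise, extended linearly. For an ideal $K$ of $R$, $\int_K M=\{G\in S: K\circ G\subset M\}$. For $f\in S$ the $i$-primitive $\int_i f$ is the unique polynomial $g\in S$ with $x_i\circ g=f$ and $g|_{y_i=0}=0$; explicitly $\int_i f=y_if$. The notation $|_{y_{k+1}=\cdots=y_n=0}$ means substituting $0$ for these variables. *)

(* Defs.v *)
From HB Require Import structures.
From mathcomp Require Import all_boot all_order all_algebra.
From mathcomp Require Import boolp.
From mathcomp Require Export mpoly.

Set Implicit Arguments.
Unset Strict Implicit.
Unset Printing Implicit Defensive.

Import GRing.Theory.
Local Open Scope ring_scope.

(* Formal power series in n variables, given by their coefficients. *)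
Record mpseries (n : nat) (k : nzRingType) :=
  MPSeries { pscoef :> 'X_{1..n} -> k }.

HB.instance Definition _ n k := gen_eqMixin (mpseries n k).
HB.instance Definition _ n k := gen_choiceMixin (mpseries n k).

Section PowerSeriesRing.
Context {n : nat} {k : comNzRingType}.
Implicit Types (F G H : mpseries n k) (a c : 'X_{1..n}).

Lemma mpseriesP F G : (forall a, F a = G a) -> F = G.
Proof. by case: F G => [F] [G] /= /funext->. Qed.

Definition ps0 : mpseries n k := MPSeries (fun=> 0).
Definition psopp F := MPSeries (fun a => - F a).
Definition psadd F G := MPSeries (fun a => F a + G a).

Fact psaddA : associative psadd.
Proof. by move=> F G H; apply: mpseriesP => a /=; rewrite addrA. Qed.
Fact psaddC : commutative psadd.
Proof. by move=> F G; apply: mpseriesP => a /=; rewrite addrC. Qed.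
Fact psadd0 : left_id ps0 psadd.
Proof. by move=> F; apply: mpseriesP => a /=; rewrite add0r. Qed.
Fact psaddN : left_inverse ps0 psopp psadd.
Proof. by move=> F; apply: mpseriesP => a /=; rewrite addNr. Qed.

HB.instance Definition _ :=
  GRing.isZmodule.Build (mpseries n k) psaddA psaddC psadd0 psaddN.

Definition psC (c : k) : mpseries n k :=
  MPSeries (fun a => if a == 0%MM then c else 0).
Definition psmul F G := MPSeries (fun c =>
  \sum_(a : 'X_{1..n < (mdeg c).+1, (mdeg c).+1} | c == (a.1 + a.2)%MM)
    F a.1 * G a.2).

Definition pstrunc d F : {mpoly k[n]} := \sum_(a : 'X_{1..n < d}) F a *: 'X_[a].

Lemma mcoeff_pstrunc d F c :
  (pstrunc d F)@_c = if (mdeg c < d)%N then F c else 0.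
Proof.
rewrite /pstrunc raddf_sum /=; case: ltnP => [lt_cd | le_dc].
  rewrite (bigD1 (BMultinom lt_cd)) //= big1 => [|a /negPf ne_ac].
    by rewrite mcoeffZ mcoeffX eqxx mulr1 addr0.
  by rewrite mcoeffZ mcoeffX -[_ == c]/(a == BMultinom lt_cd) ne_ac mulr0.
apply: big1 => a _; rewrite mcoeffZ mcoeffX; case: eqP => [eq_ac|]; rewrite ?mulr0 //.
by have := bmdeg a; rewrite eq_ac ltnNge le_dc.
Qed.

Lemma psmul_poly (p q : {mpoly k[n]}) F G c :
  (forall a, (a <= c)%MM -> p@_a = F a) ->
  (forall a, (a <= c)%MM -> q@_a = G a) ->
  psmul F G c = (p * q)@_c.
Proof.
move=> pF qG; rewrite mcoeffM; apply: eq_bigr => a /eqP c_def.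
by rewrite pF ?qG // [X in (_ <= X)%MM]c_def ?lem_addr ?lem_addl.
Qed.

Lemma lem_mdeg_lt a c d : (a <= c)%MM -> (mdeg c < d)%N -> (mdeg a < d)%N.
Proof.
by move=> /submK <-; rewrite mdegD; apply/leq_ltn_trans/leq_addl.
Qed.

Lemma psmul_trunc d F G c : (mdeg c < d)%N ->
  psmul F G c = (pstrunc d F * pstrunc d G)@_c.
Proof.
move=> lt_cd; apply: psmul_poly => a le_ac;
by rewrite mcoeff_pstrunc (lem_mdeg_lt le_ac).
Qed.

Fact psmulC : commutative psmul.
Proof.
move=> F G; apply: mpseriesP => c.
by rewrite !(psmul_trunc _ _ (ltnSn (mdeg c))) mulrC.
Qed.

Fact psmulA : associative psmul.
Proof.
move=> F G H; apply: mpseriesP => c; pose d := (mdeg c).+1.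
have lt_cd a : (a <= c)%MM -> (mdeg a < d)%N by move/lem_mdeg_lt; apply.
rewrite (@psmul_poly (pstrunc d F) (pstrunc d G * pstrunc d H)); first last.
- by move=> a /lt_cd lt_ad; rewrite (psmul_trunc _ _ lt_ad).
- by move=> a /lt_cd lt_ad; rewrite mcoeff_pstrunc lt_ad.
rewrite (@psmul_poly (pstrunc d F * pstrunc d G) (pstrunc d H)) ?mulrA //.
- by move=> a /lt_cd lt_ad; rewrite (psmul_trunc _ _ lt_ad).
- by move=> a /lt_cd lt_ad; rewrite mcoeff_pstrunc lt_ad.
Qed.

Lemma psCmulE x F c : psmul (psC x) F c = x * F c.
Proof.
rewrite (@psmul_poly x%:MP (pstrunc (mdeg c).+1 F)).
- by rewrite mcoeffCM mcoeff_pstrunc ltnSn.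
- by move=> a _; rewrite mcoeffC /=; case: eqP; rewrite ?mulr1 ?mulr0.
- by move=> a le_ac; rewrite mcoeff_pstrunc (lem_mdeg_lt le_ac).
Qed.

Fact psmul1 : left_id (psC 1) psmul.
Proof. by move=> F; apply: mpseriesP => c; rewrite psCmulE mul1r. Qed.

Fact psmulDl : left_distributive psmul psadd.
Proof.
move=> F G H; apply: mpseriesP => c; rewrite /= -big_split /=.
by apply: eq_bigr => a _; rewrite mulrDl.
Qed.

Fact ps1_neq0 : psC 1 != ps0.
Proof.
apply/eqP => /(congr1 (fun F : mpseries n k => F 0%MM)) /= /eqP.
by rewrite eqxx oner_eq0.
Qed.

HB.instance Definition _ := GRing.Zmodule_isComNzRing.Build (mpseries n k)
  psmulA psmulC psmul1 psmulDl ps1_neq0.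

Definition psX (i : 'I_n) : mpseries n k :=
  MPSeries (fun a => if a == U_(i)%MM then 1 else 0).

Lemma psDE F G c : (F + G) c = F c + G c. Proof. by []. Qed.
Lemma psNE F c : (- F) c = - F c. Proof. by []. Qed.
Lemma ps0E c : (0 : mpseries n k) c = 0. Proof. by []. Qed.
Lemma ps1E c : (1 : mpseries n k) c = if c == 0%MM then 1 else 0.
Proof. by []. Qed.
Lemma psME F G c : (F * G) c = psmul F G c. Proof. by []. Qed.

End PowerSeriesRing.

Section Contraction.
Context {n : nat} {k : comNzRingType}.
Implicit Types (F G : mpseries n k) (P Q : {mpoly k[n]}) (a c : 'X_{1..n}).

(* The linear extension of x^a o y^b = y^(b - a) if a <= b, and 0 otherwise. *)
Definition contr_mon a P : {mpoly k[n]} :=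
  \sum_(b <- msupp P | (a <= b)%MM) P@_b *: 'X_[b - a].

(* Only the monomials of F of degree at most deg P act nontrivially on P. *)
Definition contr F P : {mpoly k[n]} :=
  \sum_(a : 'X_{1..n < msize P}) F a *: contr_mon a P.

Lemma mcoeff_contr_mon a P c : (contr_mon a P)@_c = P@_(a + c).
Proof.
rewrite /contr_mon raddf_sum /=.
rewrite (eq_bigr (fun b => if b == (a + c)%MM then P@_(a + c) else 0)).
  rewrite -big_mkcondr /= -big_filter.
  have [inP|ninP] := boolP ((a + c)%MM \in msupp P).
    rewrite (perm_big [:: (a + c)%MM]) ?big_seq1 //=.
    apply: uniq_perm => //; first by rewrite filter_uniq ?msupp_uniq.
    move=> b; rewrite mem_filter inE.
    by case: eqP => [->|_]; rewrite ?andbF // lem_addr inP.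
  by rewrite (memN_msupp_eq0 ninP) big1_eq.
move=> b le_ab; rewrite mcoeffZ mcoeffX.
have ->: (b - a == c)%MM = (b == a + c)%MM.
  apply/eqP/eqP => [<-|->]; first by rewrite addmC submK.
  by rewrite addmC addmK.
by case: eqP => [->|_]; rewrite ?mulr1 ?mulr0.
Qed.

Lemma bmnm_sum_widen (f : 'X_{1..n} -> k) d d' : (d <= d')%N ->
  (forall a, (d <= mdeg a)%N -> f a = 0) ->
  \sum_(a : 'X_{1..n < d}) f a = \sum_(a : 'X_{1..n < d'}) f a.
Proof.
move=> le_dd f0; pose bseq e := [seq bmnm a | a : 'X_{1..n < e}].
have mem_bseq e a : (a \in bseq e) = (mdeg a < e)%N.
  apply/imageP/idP => [[b _ ->]|lt_ae]; first exact: bmdeg.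
  by exists (BMultinom lt_ae).
have uniq_bseq e : uniq (bseq e).
  by rewrite map_inj_uniq ?enum_uniq // => a b /val_inj.
have sumE e : \sum_(a : 'X_{1..n < e}) f a = \sum_(a <- bseq e) f a.
  by rewrite big_image.
rewrite !sumE [RHS](bigID (fun a => mdeg a < d)%N) /=.
rewrite [X in _ + X]big1 ?addr0 => [|a]; last by rewrite -leqNgt => /f0.
rewrite -[RHS]big_filter; apply/perm_big/uniq_perm; rewrite ?filter_uniq //.
move=> a; rewrite mem_filter !mem_bseq.
by case: ltnP => //= /leq_trans->.
Qed.

Lemma mcoeff_contr d F P c : (msize P <= d)%N ->
  (contr F P)@_c = \sum_(a : 'X_{1..n < d}) F a * P@_(a + c).
Proof.
move=> le_Pd.
have lt_d (a : 'X_{1..n}) : (msize P <= mdeg a)%N -> P@_(a + c) = 0.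
  move=> le_Pa; apply/memN_msupp_eq0/msize_mdeg_ge.
  by rewrite mdegD (leq_trans le_Pa) ?leq_addr.
rewrite /contr raddf_sum /=.
under eq_bigr => a _ do rewrite mcoeffZ mcoeff_contr_mon.
by apply: (@bmnm_sum_widen (fun a => F a * P@_(a + c))) => // a /lt_d ->; rewrite mulr0.
Qed.

Fact contrA F G P : contr F (contr G P) = contr (F * G) P.
Proof.
apply/mpolyP => c; set D := maxn (msize P) (msize (contr G P)).
have le_PD : (msize P <= D)%N by rewrite leq_maxl.
rewrite !(@mcoeff_contr D) ?leq_maxr //.
pose Q := MPSeries (fun e => P@_(e + c)).
have QE x : P@_(x + c) = \sum_(e : 'X_{1..n < D}) Q e * (bmnm e == x)%:R.
  transitivity (pstrunc D Q)@_x.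
    rewrite mcoeff_pstrunc; case: ltnP => // le_Dx.
    apply/memN_msupp_eq0/msize_mdeg_ge/(leq_trans le_PD).
    by rewrite mdegD (leq_trans le_Dx) ?leq_addr.
  by rewrite raddf_sum /=; apply: eq_bigr => e _; rewrite mcoeffZ mcoeffX.
transitivity (\sum_(a : 'X_{1..n < D}) \sum_(b : 'X_{1..n < D})
  \sum_(e : 'X_{1..n < D}) F a * G b * (bmnm e == a + b)%MM%:R * Q e).
  apply: eq_bigr => a _; rewrite (@mcoeff_contr D) // mulr_sumr.
  apply: eq_bigr => b _; rewrite addmA [(b + a)%MM]addmC QE mulrA mulr_sumr.
  by apply: eq_bigr => e _; rewrite -[RHS]mulrA [Q e * _]mulrC.
under eq_bigr => a _ do rewrite exchange_big /=.
rewrite exchange_big /=; apply: eq_bigr => e _.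
rewrite -[X in _ = X * _]/(psmul F G e) (psmul_trunc F G (bmdeg e)) mulr_suml raddf_sum /= mulr_suml.
apply: eq_bigr => a _; rewrite mulr_sumr raddf_sum /= mulr_suml.
apply: eq_bigr => b _.
rewrite -scalerAl -scalerAr scalerA mcoeffZ -mpolyXD mcoeffX.
by rewrite [(a + b)%MM == _]eq_sym.
Qed.

Fact contr1 : left_id 1 contr.
Proof.
move=> P; apply/mpolyP => c; rewrite (@mcoeff_contr (msize P).+1) //.
rewrite (bigD1 (BMultinom (bm0_proof n (msize P)))) //= eqxx mul1r add0m.
rewrite big1 ?addr0 // => a ne_a0.
by case: eqP => [a0|]; rewrite ?mul0r //; case/eqP: ne_a0; apply/val_inj.
Qed.

Fact contrDr : right_distributive contr +%R.
Proof.
move=> F P Q; apply/mpolyP => c.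
set D := maxn (msize (P + Q)) (maxn (msize P) (msize Q)).
rewrite mcoeffD !(@mcoeff_contr D) ?leq_max ?leqnn ?orbT // -big_split /=.
by apply: eq_bigr => a _; rewrite mcoeffD mulrDr.
Qed.

Fact contrDl P : {morph contr^~ P : F G / F + G}.
Proof.
move=> F G; rewrite /contr -big_split /=.
by apply: eq_bigr => a _; rewrite scalerDl.
Qed.

Lemma mcoeff_contrX i P c : (contr (psX i) P)@_c = P@_(U_(i) + c).
Proof.
rewrite (@mcoeff_contr (msize P).+2) 1?ltnW //.
have ltU : (mdeg U_(i) < (msize P).+2)%N by rewrite mdeg1.
rewrite (bigD1 (BMultinom ltU)) //= eqxx mul1r.
rewrite big1 ?addr0 // => a ne_a.
by case: eqP => [aU|]; rewrite ?mul0r //; case/eqP: ne_a; apply/val_inj.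
Qed.

End Contraction.

(* An alias of {mpoly k[n]}, so that *: is contraction by power series here
   and scaling by k on {mpoly k[n]}. *)
Definition contrModule (n : nat) (k : comNzRingType) : Type := {mpoly k[n]}.

HB.instance Definition _ n (k : comNzRingType) :=
  GRing.Zmodule.copy (contrModule n k) {mpoly k[n]}.
HB.instance Definition _ n (k : comNzRingType) :=
  GRing.Zmodule_isLmodule.Build (mpseries n k) (contrModule n k)
    (@contrA n k) (@contr1 n k) (@contrDr n k) (@contrDl n k).

Section MaximalIdeal.
Context {n : nat} {k : fieldType}.
Implicit Types (F G : mpseries n k) (J : {pred mpseries n k}).

Definition maxideal : {pred mpseries n k} := [pred F : mpseries n k | F 0%MM == 0].

Lemma lepm0 (a : 'X_{1..n}) : (a <= 0)%MM -> a = 0%MM.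
Proof.
by move=> /mnm_lepP le_a0; apply/mnmP => i; have := le_a0 i; rewrite mnm0E leqn0 => /eqP.
Qed.

Lemma psM0 F G : (F * G) 0%MM = F 0%MM * G 0%MM.
Proof.
rewrite psME (@psmul_poly _ _ (F 0%MM)%:MP (G 0%MM)%:MP).
- by rewrite mcoeffCM mcoeffC eqxx mulr1.
- by move=> a /lepm0->; rewrite mcoeffC eqxx mulr1.
- by move=> a /lepm0->; rewrite mcoeffC eqxx mulr1.
Qed.

Lemma maxideal_idealr : idealr_closed maxideal.
Proof.
split=> [||F G H]; rewrite ?inE ?ps0E ?ps1E ?eqxx ?oner_eq0 //.
by move=> /eqP G0 /eqP H0; rewrite psDE psM0 G0 H0 mulr0 addr0.
Qed.

Lemma psX_expr_eq0 F i c : F 0%MM = 0 -> (mdeg c < i)%N -> (F ^+ i) c = 0.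
Proof.
move=> F0; elim: i c => // i IHi c lt_ci; rewrite exprS psME /=.
apply: big1 => -[a b] /= /eqP c_def.
have [a0|a_neq0] := eqVneq (bmnm a) 0%MM; first by rewrite a0 F0 mul0r.
have /(congr1 mdeg) := c_def; rewrite mdegD => cE.
rewrite IHi ?mulr0 //; apply: leq_trans (lt_ci : (mdeg c <= i)%N).
by rewrite [X in (_ < X)%N]cE -[X in (X < _)%N]add0n ltn_add2r lt0n mdeg_eq0.
Qed.

Lemma notin_maxideal F : F \notin maxideal -> exists G, F * G = 1.
Proof.
rewrite inE => F0; pose u := 1 - psC (F 0%MM)^-1 * F.
have u0 : u 0%MM = 0.
  by rewrite psDE psNE ps1E eqxx psME psCmulE mulVf ?subrr.
pose G := MPSeries (fun c => (\sum_(i < (mdeg c).+1) u ^+ i) c).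
have GE d c : (mdeg c < d)%N -> G c = (\sum_(i < d) u ^+ i) c.
  move=> lt_cd; rewrite -[G c]/((\sum_(i < (mdeg c).+1) u ^+ i) c).
  rewrite -!(big_mkord xpredT (fun i => u ^+ i)).
  rewrite [in RHS](@big_cat_nat _ _ _ (mdeg c).+1) // psDE.
  have sum0 (r : seq nat) : (forall i, i \in r -> (mdeg c < i)%N) ->
      (\sum_(i <- r) u ^+ i) c = 0.
    elim: r => [|i r IHr] r_gt; first by rewrite big_nil.
    rewrite big_cons psDE psX_expr_eq0 ?r_gt ?mem_head // add0r.
    by apply: IHr => j rj; rewrite r_gt // inE rj orbT.
  by rewrite [X in _ + X]sum0 ?addr0 // => i; rewrite mem_index_iota => /andP[].
have uG : (1 - u) * G = 1.
  apply: mpseriesP => c; pose S := \sum_(i < (mdeg c).+1) u ^+ i.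
  have ->: ((1 - u) * G) c = ((1 - u) * S) c.
    rewrite !psME /=; apply: eq_bigr => -[a b] /= _.
    by rewrite -(GE (mdeg c).+1) ?bmdeg.
  rewrite -(opprB u) mulNr -subrX1 opprB psDE psNE psX_expr_eq0 //.
  by rewrite oppr0 addr0.
exists (psC (F 0%MM)^-1 * G); rewrite mulrA [F * _]mulrC.
by rewrite -uG /u opprB addrC subrK.
Qed.

(* Hence maxideal is the unique maximal ideal. *)
Lemma proper_sub_maxideal J : idealr_closed J -> {subset J <= maxideal}.
Proof.
case=> J0 J1 JD F JF; apply: contraNT J1 => /notin_maxideal[G FG1].
by rewrite -FG1 mulrC -[_ * _]addr0 JD.
Qed.

End MaximalIdeal.

Section Primitives.
Context {n : nat} {k : fieldType}.
Implicit Types (P Q : {mpoly k[n]}) (i : 'I_n).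

(* Membership of P in the integral of M along K: K o P is contained in M. *)
Definition int_ideal (K : {pred mpseries n k})
    (M : {pred contrModule n k}) (P : {mpoly k[n]}) : Prop :=
  forall F, F \in K -> contr F P \in M.

Definition primitive i P : {mpoly k[n]} := 'X_i * P.

(* Substitution of 0 for the variables in Z. *)
Definition zero_vars (Z : pred 'I_n) P : {mpoly k[n]} :=
  P \mPo [tuple if Z j then 0 else 'X_j | j < n].

Lemma mcoeff_zero_vars Z P c : (zero_vars Z P)@_c =
  if [forall j, Z j ==> (c j == 0)%N] then P@_c else 0.
Proof.
rewrite /zero_vars comp_mpolyEX.
have XE b : 'X_[b] \mPo [tuple if Z j then 0 else 'X_j | j < n] =
    if [forall j, Z j ==> (b j == 0)%N] then 'X_[b] else 0 :> {mpoly k[n]}.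
  rewrite comp_mpolyX; case: ifPn => [/forallP Zb|].
    rewrite [RHS]mpolyXE_id; apply: eq_bigr => j _; rewrite tnth_mktuple.
    by case: ifP (Zb j) => //= _ /eqP->; rewrite !expr0.
  rewrite negb_forall => /existsP[j]; rewrite negb_imply => /andP[Zj bj].
  by rewrite (bigD1 j) //= tnth_mktuple Zj expr0n (negPf bj) mul0r.
rewrite raddf_sum /=; case: ifPn => Zc.
  rewrite [in RHS](mpolyE P) raddf_sum /=; apply: eq_bigr => b _.
  rewrite XE !mcoeffZ; case: ifPn => // Zb; rewrite mcoeff0 mcoeffX.
  by case: eqP => // eq_bc; rewrite eq_bc Zc in Zb.
apply: big1 => b _; rewrite XE mcoeffZ; case: ifPn => Zb; last by rewrite mcoeff0 mulr0.
rewrite mcoeffX; case: eqP => [eq_bc|]; last by rewrite mulr0.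
by rewrite -eq_bc Zb in Zc.
Qed.

Lemma primitiveP i P Q :
  Q = primitive i P <-> contr (psX i) Q = P /\ zero_vars (pred1 i) Q = 0.
Proof.
have iP0 : zero_vars (pred1 i) (primitive i P) = 0.
  rewrite /zero_vars rmorphM /= comp_mpolyXU -tnth_nth tnth_mktuple /=.
  by rewrite eqxx mul0r.
have XiP c : (primitive i P)@_(U_(i) + c) = P@_c.
  by rewrite /primitive mulrC mcoeffMX.
split=> [->|[QP Q0]].
  by split=> //; apply/mpolyP => c; rewrite mcoeff_contrX XiP.
apply/mpolyP => c; have [c0|c_gt0] := posnP (c i).
  have cE T : zero_vars (pred1 i) T = 0 -> T@_c = 0.
    move/(congr1 (mcoeff c)); rewrite mcoeff_zero_vars mcoeff0.
    case: forallP => // -[j]; apply/implyP => /eqP->; exact/eqP.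
  by rewrite !cE.
have <-: (U_(i) + (c - U_(i)))%MM = c.
  by rewrite addmC submK // lep1mP -lt0n.
by rewrite XiP -mcoeff_contrX QP.
Qed.

End Primitives.

Section Basis.
Context {k : fieldType} {V : lmodType k}.

(* The vectors b_j of V form a k-basis of the subspace M. *)
Definition is_basis (M : {pred V}) (s : nat) (b : 'I_s -> V) : Prop :=
  (forall c : 'I_s -> k, \sum_(j < s) c j *: b j = 0 -> forall j, c j = 0) /\
  (forall v, v \in M <-> exists c : 'I_s -> k, v = \sum_(j < s) c j *: b j).

End Basis.

(* Main.v *)
(* Put g_i = sum_j lam i j b_j, an element of M.  The right-hand side of the
   first equation has no constant term, and its coefficient at y^c is that of
   g_m at y^c / y_m, where y_m is the last variable dividing y^c.  Hence the
   equation holds when g_i = x_i o L for all i.  Conversely it gives x_i o L and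
   g_i the same coefficients at monomials in y_1, .., y_i, and the relations
   x_l o g_i = x_i o g_l extend this to all monomials, moving a last variable
   y_l with l > i from one side to the other.  Finally, the maximal ideal being
   generated by the x_i, L is in the integral of M iff all x_i o L are in M. *)
Require Import Defs.
From mathcomp Require Import all_boot all_order all_algebra.
From mathcomp Require Import mpoly.

Set Implicit Arguments.
Unset Strict Implicit.
Unset Printing Implicit Defensive.

Import GRing.Theory.
Local Open Scope ring_scope.

Lemma mnm_addCA (n : nat) : left_commutative (@mnm_add n).
Proof. by move=> a b c; rewrite !addmA [(a + b)%MM]addmC. Qed.

(** Take for [m] the largest index with nonzero exponent; the quotient [d] may still involve the
    variable [m]. *)
Lemma mnm_last_var (n : nat) (c : 'X_{1..n}) : c != 0%MM ->
  exists m d, c = (U_(m) + d)%MM /\ forall l : 'I_n, (m < l)%N -> d l = 0%N.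
Proof.
rewrite -mdeg_eq0 mdegE sum_nat_eq0 negb_forall => /existsP[i0 /= ci0].
case: (@arg_maxnP _ i0 (fun i => c i != 0%N) (fun i => i : nat) ci0) => m cm mP.
exists m, (c - U_(m))%MM; split=> [|l lt_ml].
  by rewrite addmC submK // lep1mP.
rewrite mnmBE; have [->//|/mP] := eqVneq (c l) 0%N.
by rewrite /= leqNgt lt_ml.
Qed.

Lemma mcoeff_primitive (n : nat) (k : fieldType) (i : 'I_n) (P : {mpoly k[n]})
    (c : 'X_{1..n}) :
  (primitive i P)@_c = if c i == 0%N then 0 else P@_(c - U_(i)).
Proof.
have [contrP zeroP] := (primitiveP i P (primitive i P)).1 erefl.
case: eqP => [ci0|/eqP ci].
  have := congr1 (mcoeff c) zeroP; rewrite mcoeff_zero_vars mcoeff0.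
  case: forallP => // -[j]; apply/implyP => /eqP->; exact/eqP.
by rewrite -{2}contrP mcoeff_contrX addmC submK // lep1mP.
Qed.

Section IteratedPrimitive.
Context {n : nat} {k : fieldType} (g : 'I_n -> {mpoly k[n]}).

(** Setting the variables after [i] to zero leaves each monomial to the summand of its last
    variable, so none is counted twice. *)
Definition iter_primitive : {mpoly k[n]} :=
  \sum_(i < n) zero_vars [pred l : 'I_n | (i < l)%N] (primitive i (g i)).

Lemma mcoeff0_iter_primitive : iter_primitive@_0%MM = 0.
Proof.
rewrite raddf_sum big1 //= => i _.
by rewrite mcoeff_zero_vars mcoeff_primitive mnm0E eqxx if_same.
Qed.

(** Summands with [i < m] lose the monomial when variable [m] is set to zero; those with [m < i]
    have only multiples of variable [i], which does not divide it. *)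
Lemma mcoeff_iter_primitive (m : 'I_n) (d : 'X_{1..n}) :
  (forall l : 'I_n, (m < l)%N -> d l = 0%N) ->
  iter_primitive@_(U_(m) + d) = (g m)@_d.
Proof.
move=> d0; rewrite raddf_sum (bigD1 m) //= [X in _ + X]big1 ?addr0.
  rewrite mcoeff_zero_vars mcoeff_primitive mnmDE mnm1E eqxx addmC addmK /=.
  case: forallP => // -[l]; apply/implyP => /= lt_ml.
  by rewrite mnmDE mnm1E d0 // -val_eqE /= (ltn_eqF lt_ml).
move=> i ne_im; rewrite mcoeff_zero_vars mcoeff_primitive.
have Ui : (U_(m)%MM i = 0)%N by rewrite mnm1E eq_sym (negPf ne_im).
have [lt_im|le_mi] := ltnP i m.
  case: forallP => // /(_ m); rewrite /= lt_im mnmDE mnm1E eqxx.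
  by rewrite addn_eq0.
rewrite mnmDE Ui d0 ?eqxx ?if_same // ltn_neqAle le_mi andbT.
by rewrite eq_sym val_eqE.
Qed.

(** A contraction analogue of the Poincaré lemma: [L] is a potential of [g], and the relations say
    that [g] is closed. *)
Lemma iter_primitiveP (L : {mpoly k[n]}) : L@_0%MM = 0 ->
  L = iter_primitive /\
    (forall i l : 'I_n, (i < l)%N ->
       contr (psX l) (g i) = contr (psX i) (g l))
  <-> forall i, contr (psX i) L = g i.
Proof.
move=> L0; split=> [[defL gC] i | Lg].
  apply/mpolyP => c; rewrite mcoeff_contrX.
  (* In the first case [i] is the last variable of [U_(i) + c]. *)
  have [c0|] := boolP [forall l : 'I_n, (i < l)%N ==> (c l == 0)%N].
    rewrite defL mcoeff_iter_primitive // => l.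
    by have /forallP/(_ l)/implyP il := c0 => /il/eqP.
  rewrite negb_forall => /existsP[l]; rewrite negb_imply => /andP[lt_il cl].
  have [|m [d [c_def d0]]] := @mnm_last_var _ c.
    by apply: contraNneq cl => ->; rewrite mnm0E.
  have lt_im : (i < m)%N.
    rewrite ltnNge; apply: contraNN cl => le_mi.
    have lt_ml := leq_ltn_trans le_mi lt_il.
    by rewrite c_def mnmDE mnm1E d0 // -val_eqE /= (ltn_eqF lt_ml).
  (* Now [m] is the last variable of [U_(i) + c], so the coefficient is that of [g m] at
     [U_(i) + d]; [gC] turns it into that of [g i] at [U_(m) + d]. *)
  rewrite c_def mnm_addCA defL mcoeff_iter_primitive; first last.
    move=> j lt_mj; rewrite mnmDE mnm1E d0 // -val_eqE /=.
    by rewrite (ltn_eqF (ltn_trans lt_im lt_mj)).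
  by rewrite -!mcoeff_contrX -gC.
split=> [|i l _]; last first.
  by apply/mpolyP => c; rewrite -!Lg !mcoeff_contrX mnm_addCA.
apply/mpolyP => c; have [->|/mnm_last_var[m [d [-> d0]]]] := eqVneq c 0%MM.
  by rewrite L0 mcoeff0_iter_primitive.
by rewrite mcoeff_iter_primitive // -Lg mcoeff_contrX.
Qed.

End IteratedPrimitive.

Definition psmon (n : nat) (k : nzRingType) (x : k) (a : 'X_{1..n}) :=
  MPSeries (fun e => if e == a then x else 0).

Lemma mcoeff_contr_psmon (n : nat) (k : comNzRingType) (x : k)
    (a c : 'X_{1..n}) (P : {mpoly k[n]}) :
  (contr (psmon x a) P)@_c = x * P@_(a + c).
Proof.
rewrite (@mcoeff_contr _ _ (maxn (msize P) (mdeg a).+1)) ?leq_maxl //.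
have lt_a : (mdeg a < maxn (msize P) (mdeg a).+1)%N by rewrite leq_maxr.
rewrite (bigD1 (BMultinom lt_a)) //= eqxx big1 ?addr0 // => e ne_e.
by case: eqP => [ea|]; rewrite ?mul0r //; case/eqP: ne_e; apply/val_inj.
Qed.

(** In the finite sum [contr F L] the term at exponent 0 vanishes, and any other factors through
    some [contr (psX i) L]. *)
Lemma int_maxidealP (n : nat) (k : fieldType) (M : {pred contrModule n k})
    (L : {mpoly k[n]}) : GRing.submod_closed M ->
  int_ideal maxideal M L <-> forall i, contr (psX i) L \in M.
Proof.
case=> M0 MD; split=> [ML i | ML F].
  by apply: ML; rewrite inE /= [_ == U_(i)%MM]eq_sym -mdeg_eq0 mdeg1 eqxx.
rewrite inE => /eqP F0; rewrite /contr.
elim/big_rec: _ => [|a Q _ MQ]; first exact: M0.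
have [a0|a_neq0] := eqVneq (bmnm a) 0%MM; first by rewrite a0 F0 scale0r add0r.
have [i [d [a_def _]]] := mnm_last_var a_neq0.
have -> : F a *: contr_mon a L = contr (psmon (F a) d) (contr (psX i) L).
  apply/mpolyP => c; rewrite mcoeffZ mcoeff_contr_mon mcoeff_contr_psmon.
  by rewrite mcoeff_contrX addmA -a_def.
(* The scaling in [MD] is that of [contrModule], namely contraction by a series. *)
exact: (MD (psmon (F a) d) _ _ (ML i) MQ).
Qed.

Theorem theorem3p8 (k : fieldType) (n s : nat)
    (M : {pred contrModule n k}) (hM : GRing.submod_closed M)
    (b : 'I_s -> {mpoly k[n]}) (hb : is_basis (M : {pred {mpoly k[n]}}) b)
    (L : {mpoly k[n]}) (hL : L@_0%MM = 0) :
  int_ideal maxideal M L <->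
  exists lam : 'I_n -> 'I_s -> k,
    L = \sum_(i < n) \sum_(j < s)
          lam i j *: zero_vars [pred l : 'I_n | (i < l)%N] (primitive i (b j))
    /\ forall i l : 'I_n, (i < l)%N ->
         \sum_(j < s) lam i j *: contr (psX l) (b j)
         - \sum_(j < s) lam l j *: contr (psX i) (b j) = 0.
Proof.
pose g (lam : 'I_n -> 'I_s -> k) i : {mpoly k[n]} := \sum_(j < s) lam i j *: b j.
have gM (lam : 'I_n -> 'I_s -> k) i : g lam i \in M.
  by apply/(proj2 hb); exists (lam i).
have contr_g lam i l :
    \sum_(j < s) lam i j *: contr (psX l) (b j) = contr (psX l) (g lam i).
  apply/mpolyP => c; rewrite mcoeff_contrX !raddf_sum /=.
  by apply: eq_bigr => j _; rewrite !mcoeffZ mcoeff_contrX.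
have sum_g lam : \sum_(i < n) \sum_(j < s)
    lam i j *: zero_vars [pred l : 'I_n | (i < l)%N] (primitive i (b j))
    = iter_primitive (g lam).
  apply: eq_bigr => i _; rewrite /zero_vars /primitive mulr_sumr raddf_sum /=.
  by apply: eq_bigr => j _; rewrite -scalerAr linearZ.
rewrite int_maxidealP //; split=> [ML | [lam [defL lamC]] i].
  (* The scalars are the coordinates of each [contr (psX i) L] in the basis [b]. *)
  have [lam lamP] : exists lam, forall i, contr (psX i) L = g lam i.
    have /fin_all_exists[lam lamP] i := (proj2 hb _).1 (ML i).
    by exists lam.
  exists lam; have [defL gC] := (iter_primitiveP (g lam) hL).2 lamP.
  rewrite sum_g; split=> // i l lt_il.
  by rewrite !contr_g gC // subrr.
rewrite (iter_primitiveP (g lam) hL).1 ?gM //; split; first by rewrite -sum_g.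
by move=> i' l /lamC/subr0_eq; rewrite !contr_g.
Qed.
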